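(* Let $d\ge1$, let $\Psi(\lambda\mu^E)$ be a Poisson process on $\mathbb{R}^d\times(0,1]$ with intensity measure $\lambda\mu^E$, $\lambda>0$, where $$\mu^E(\mathrm{d}(x,r))=\ell_d(\mathrm{d}x)\times\mathbf{1}(0<r\le1)\,r^{-(d+1)}\,\mathrm{d}r,$$ and let $\mathcal{C}(\lambda\mu^E)=\bigcup_{(x,r)\in\Psi(\lambda\mu^E)}B(x,r)$. Define $$\lambda_{\rm sheet}:=\sup\{\lambda>0:\ \mathbb{P}(\mathcal{C}(\lambda\mu^E)\text{ contains only bounded components})=1\}.$$ Then $\lambda_{\rm sheet}>0$.
   Context: $\ell_d$ is Lebesgue measure on $\mathbb{R}^d$; $B(x,r)$ is the open Euclidean ball with centre $x$ and radius $r$. ''Components'' are connected components of the random open set $\mathcal{C}(\lambda\mu^E)$. The Poisson process is identified with its random countable support. The supremum of the empty set is understood to be $0$, so the claim says that there is some $\lambda>0$ for which almost surely all components are bounded. *)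

(* Defs.v *)
From HB Require Import structures.
From mathcomp Require Import all_boot all_order all_algebra.
From mathcomp Require Import all_classical all_reals all_analysis.
From mathcomp Require Import measurable_realfun.

Set Implicit Arguments.
Unset Strict Implicit.
Unset Printing Implicit Defensive.
Import Order.TTheory GRing.Theory Num.Theory.
Import numFieldNormedType.Exports.
Local Open Scope classical_set_scope.
Local Open Scope ring_scope.

(* The sigma-algebra of 'rV[R]_n is the one generated by the n coordinate maps
   (as the library does for tuples), i.e. the Borel sigma-algebra of R^n. *)
Section measurable_rV.
Context (R : realType) (n : nat).

Let coor : 'I_n -> 'rV[R]_n -> measurableTypeR R := fun i x => x ord0 i.

Let rV_set0 : g_sigma_preimage coor set0.
Proof. exact: sigma_algebra0. Qed.

Let rV_setC A : g_sigma_preimage coor A -> g_sigma_preimage coor (~` A).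
Proof. exact: sigma_algebraC. Qed.

Let rV_bigcup (F : _^nat) : (forall i, g_sigma_preimage coor (F i)) ->
  g_sigma_preimage coor (\bigcup_i (F i)).
Proof. exact: sigma_algebra_bigcup. Qed.

HB.instance Definition _ := @isMeasurable.Build default_measure_display
  'rV[R]_n (g_sigma_preimage coor) rV_set0 rV_setC rV_bigcup.

Lemma measurable_coord_rV (i : 'I_n) : measurable_fun [set: 'rV[R]_n] (coor i).
Proof.
move=> _ Y mY; rewrite setTI; apply: sub_sigma_algebra => /=.
rewrite -bigcup_seq/=; exists i => /=; first by rewrite mem_index_enum.
by exists Y => //; rewrite setTI.
Qed.

Lemma measurable_fun_rV d (T : measurableType d) (f : T -> 'rV[R]_n) :
  (forall i, measurable_fun [set: T] (coor i \o f)) ->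
  measurable_fun [set: T] f.
Proof.
move=> mf.
have sub : g_sigma_preimage (fun i => coor i \o f) `<=` measurable.
  apply: smallest_sub; first exact: sigma_algebra_measurable.
  rewrite -bigcup_seq; apply: bigcup_sub => i _ _ [B mB <-]; exact: mf.
by move=> _ A mA; apply: sub; rewrite g_sigma_preimage_comp; exists A.
Qed.

End measurable_rV.

Section lebesgue_rV.
Context (R : realType).
Local Open Scope ereal_scope.

Definition rV_rcons n (p : 'rV[R]_n * measurableTypeR R) : 'rV[R]_n.+1 :=
  (\row_i (if unlift ord_max i is Some j then p.1 ord0 j else p.2))%R.

Lemma measurable_rV_rcons n :
  measurable_fun [set: 'rV[R]_n * measurableTypeR R] (@rV_rcons n).
Proof.
apply: measurable_fun_rV => i; case: (unliftP ord_max i) => [j|] ->.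
- rewrite [X in measurable_fun _ X](_ : _ =
    (fun x : 'rV[R]_n => x ord0 j : measurableTypeR R) \o fst).
    by apply: measurableT_comp => //; exact: measurable_coord_rV.
  by apply/funext => p /=; rewrite mxE liftK.
- rewrite [X in measurable_fun _ X](_ : _ = snd) //.
  by apply/funext => p /=; rewrite mxE unlift_none.
Qed.

Section step.
Context (n : nat) (m : {measure set 'rV[R]_n -> \bar R}).

Definition lebesgue_rVS : set 'rV[R]_n.+1 -> \bar R :=
  pushforward (m \x (@lebesgue_measure R)) (@rV_rcons n).

HB.instance Definition _ := Measure.copy lebesgue_rVS
  (measure_function_pushforward__canonical__measure_function_Measure
     (m \x (@lebesgue_measure R)) (@measurable_rV_rcons n)).
End step.

(* d-fold product of the Lebesgue measure of the real line. *)
Fixpoint lebesgue_rV n : {measure set 'rV[R]_n -> \bar R} :=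
  match n with
  | 0%N => dirac (0%R : 'rV[R]_0)
  | n'.+1 => lebesgue_rVS (lebesgue_rV n')
  end.

End lebesgue_rV.

Section poisson_process.
Local Open Scope ereal_scope.

(* A Poisson process with values in S and with diffuse intensity measure m,
   identified with its random countable support Psi; the number of points in B
   is counting (Psi w `&` B). *)
Record is_poisson_process (R : realType) dO (Om : measurableType dO)
    (P : probability Om R) dX (X : measurableType dX) (S : set X)
    (m : set X -> \bar R) (Psi : Om -> set X) : Prop := {
  poisson_process_sub : forall w, Psi w `<=` S ;
  poisson_process_countable : forall w, countable (Psi w) ;
  poisson_process_measurable : forall B : set X, measurable B ->
    measurable_fun [set: Om] (fun w => counting (Psi w `&` B) : \bar R) ;
  poisson_process_fin : forall (B : set X) (a : R) (k : nat), measurable B ->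
    m B = a%:E ->
    P [set w | counting (Psi w `&` B) = k%:R%:E :> \bar R] =
      (expR (- a) * a ^+ k / k`!%:R)%:E ;
  poisson_process_infty : forall B : set X, measurable B -> m B = +oo ->
    P [set w | counting (Psi w `&` B) = +oo :> \bar R] = 1 ;
  poisson_process_indep : forall (n : nat) (B : 'I_n -> set X)
      (A : 'I_n -> set (\bar R)),
    (forall i, measurable (B i)) -> trivIset [set: 'I_n] B ->
    (forall i, measurable (A i)) ->
    P [set w | forall i, A i (counting (Psi w `&` B i))] =
      \prod_(i < n) P [set w | A i (counting (Psi w `&` B i))]
}.

End poisson_process.

Notation grain R d := ('rV[R]_d * measurableTypeR R)%type.

Section sheet.
Context (R : realType).

Definition grain_space (d : nat) : set (grain R d) :=
  [set p | 0 < (p.2 : R) <= 1].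

(* The density is taken with respect to the product of the Lebesgue measures of
   R^d and R. *)
Definition muE (d : nat) (B : set (grain R d)) : \bar R :=
  (\int[lebesgue_rV R d \x @lebesgue_measure R]_(p in B)
     (if (0 < (p.2 : R) <= 1)%R then (p.2 : R) ^- d.+1 else 0%R)%:E)%E.

Definition eball (d : nat) (x : 'rV[R]_d) (r : R) : set 'rV[R]_d :=
  [set y | Num.sqrt (\sum_(i < d) (y ord0 i - x ord0 i) ^+ 2) < r].

Definition coverage (d : nat) (Z : set (grain R d)) : set 'rV[R]_d :=
  \bigcup_(p in Z) eball p.1 p.2.

Definition only_bounded_components (d : nat) (U : set 'rV[R]_d) : Prop :=
  forall x, U x -> bounded_set (connected_component U x).

(* Psi l is the process at intensity l, on its own probability space; the
   element 0 makes the supremum of the empty set equal to 0. *)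
Definition lambda_sheet (d : nat) (dO : R -> measure_display)
    (Om : forall l : R, measurableType (dO l))
    (P : forall l : R, probability (Om l) R)
    (Psi : forall l : R, Om l -> set (grain R d)) : \bar R :=
  ereal_sup (0%E |` [set l%:E | l in [set l : R | 0 < l /\
    {ae P l, forall w, only_bounded_components (coverage (Psi l w))}]]).

End sheet.

(* Main.v *)
Require Import Defs.
From mathcomp Require Import all_boot all_order all_algebra.
From mathcomp Require Import all_classical all_reals all_analysis.
From mathcomp Require finmap.
From mathcomp Require Import measurable_realfun ring lra.

(** The proof is a multiscale argument.  Work with the sup norm, in which a
Euclidean ball is contained in the ball of the same centre and radius, and say
that two grains are adjacent when these larger balls overlap.  Suppose that a
chain of adjacent grains of radii at most [s] leads from distance at most [s]
of a point [z] to distance more than [2 s], and cut it at its first exit.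
Either the chain uses a grain of radius in [(s/10, s]] centred within [4 s] of
[z], or it only uses grains of radius at most [s/10].  In the second case the
chain is long compared with the next scale [s/10], so both its start and its
end see a crossing of the same kind at scale [s/10], around two of the finitely
many points of a grid of mesh [s/10]; these two points are more than [8 s/10]
apart ([no_crossing]).

Iterating, a crossing produces a binary tree whose leaves are cells of
position-radius space that all contain a grain.  The separation makes the cells
of one tree pairwise disjoint, so that the occupation events are independent
([cluster_event_prob]).  Let [w s] be the expected number of fully occupied
trees at scale [s], and [h s] the probability that one cell is occupied.  Then
[w s <= h s + N * (w (s/10)) ^ 2], where [N] depends on the dimension only.
Scale invariance of the intensity bounds [h] by [p := l * 8 ^ d * 10 ^ (d+1)]
at every scale, [l] being the intensity parameter ([hit_prob_le]).  If [4 * N * p <= 1], the recursion preserves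
the bound [w <= 2 * p], whatever the depth of the trees: infinitely many small
scales cost nothing ([weight_le]).  At scales [s >= 10] moreover [h s = 0],
because radii are at most one; the recursion becomes [w s <= N * (w (s/10)) ^ 2]
and gives [w (10 ^ j) <= 2 * p / 2 ^ j] ([weight_decay]).

A point of an unbounded component is joined to infinity by chains of grains, so
an unbounded component forces a crossing around the origin at scale [10 ^ j]
for all large [j] ([unbounded_bad]), an event of probability zero. *)

Set Implicit Arguments.
Unset Strict Implicit.
Unset Printing Implicit Defensive.
Import Order.TTheory GRing.Theory Num.Theory.
Import numFieldNormedType.Exports.
Local Open Scope classical_set_scope.
Local Open Scope ring_scope.

(** * Crossings and hierarchies of occupied cells *)

Lemma first_exit (T : eqType) (e : rel T) (a : pred T) x0 xs :
  ~~ a x0 -> a (last x0 xs) -> path e x0 xs ->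
  exists ys y, [/\ path e x0 (rcons ys y), a y,
    forall x, x \in x0 :: ys -> ~~ a x & {subset rcons ys y <= xs}].
Proof.
elim: xs x0 => [|x xs IH] x0 /= ax0; first by rewrite (negbTE ax0).
move=> al /andP[ex pxs]; have [ax|nax] := boolP (a x).
  exists [::], x; split=> //=; first by rewrite ex.
    by move=> y; rewrite inE => /eqP ->.
  by move=> y; rewrite inE => /eqP ->; rewrite mem_head.
have [ys [y [p ay h sub]]] := IH _ nax al pxs.
exists (x :: ys), y; split => //=; first by rewrite ex.
  by move=> w; rewrite inE => /orP[/eqP->//|]; exact: h.
by move=> w; rewrite !inE => /orP[->//|/sub ->]; rewrite orbT.
Qed.

Section geometry.
Context (R : realType) (d : nat).
Implicit Types (x z : 'rV[R]_d) (s : R) (p q : grain R d).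

Lemma norm_rV_le x (a : R) : 0 <= a -> (`|x| <= a) = [forall i, `|x ord0 i| <= a].
Proof.
move=> a0; rewrite [`|x|]/Num.Def.normr /= mx_normrE.
apply/bigmax_leP/forallP => [[_ h] i|h]; first exact: (h (ord0, i)).
by split=> // -[i j] _; rewrite (ord1 i); exact: h.
Qed.

Definition adj p q := `|p.1 - q.1| < (p.2 + q.2 : R).

Lemma adj_sym : symmetric adj.
Proof. by move=> p q; rewrite /adj distrC [p.2 + _]addrC. Qed.

(** The constant [4] leaves room for a chain cut at its first exit from distance
[2 s]: its last grain is within [2 s] plus two radii of the centre. *)
Definition cell (c : R * 'rV[R]_d) : set (grain R d) :=
  [set p | `|p.1 - c.2| <= 4 * c.1 /\ c.1 / 10 < (p.2 : R) <= c.1].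

(** A grid of mesh [s / 10] in which the coordinates of the nodes range from
[-22 * (s / 10)] to [22 * (s / 10)]: a chain of grains of radii at most [s / 10]
that is cut when it exits from distance [2 s] ends within [22 * (s / 10)]. *)
Definition offset := {ffun 'I_d -> 'I_45}.

Definition subcenter s z (u : offset) : 'rV[R]_d :=
  \row_i (z ord0 i + s / 10 * ((u i)%:R - 22)).

Lemma subcenter_near s z u : 0 < s -> `|subcenter s z u - z| <= 22 * (s / 10).
Proof.
move=> s0; rewrite norm_rV_le; last by lra.
have s10 : 0 <= s / 10 by lra.
apply/forallP => i; rewrite !mxE addrAC subrr add0r normrM (ger0_norm s10).
rewrite [leRHS]mulrC ler_wpM2l//.
have : ((u i)%:R <= 44 :> R) by rewrite ler_nat -ltnS.
by move: (ler0n R (u i)) => ? ?; rewrite ler_norml; lra.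
Qed.

Lemma subcenter_dense s z x : 0 < s -> `|x - z| <= 22 * (s / 10) ->
  exists u, `|x - subcenter s z u| <= s / 10.
Proof.
move=> s0; rewrite norm_rV_le; last by lra.
move=> /forallP xz.
pose t i := (x ord0 i - z ord0 i) / (s / 10) + 22.
have s10 : 0 < s / 10 by lra.
have t0 i : 0 <= t i <= 44.
  move: (xz i); rewrite !mxE ler_norml /t => /andP[h1 h2].
  rewrite -lerBlDr sub0r ler_pdivlMr// mulNr h1/=.
  by rewrite -lerBrDr ler_pdivrMr//; lra.
exists [ffun i => inord (Num.truncn (t i))].
rewrite norm_rV_le; last by lra.
apply/forallP => i; rewrite !mxE ffunE.
have /andP[ti0 ti44] := t0 i.
have := Num.Theory.truncn_itv ti0; move=> /andP[k1 k2].
rewrite inordK; last first.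
  by rewrite ltnS -(ler_nat R); apply: le_trans k1 _.
have E : x ord0 i - z ord0 i = (t i - 22) * (s / 10).
  by rewrite /t addrK divfK// gt_eqF.
rewrite opprD addrA E mulrC -mulrBr normrM (ger0_norm (ltW s10)).
rewrite ger_pMr// ler_norml; move: k2; rewrite -natr1; lra.
Qed.

(** Each element of [clusters n s z] lists the leaves of a binary tree of depth at
most [n]: a node at scale [s] either is a leaf or has two well separated
children at scale [s / 10].  A crossing between radii [s / 10 ^+ n] and [s]
occupies all the cells of such a list. *)
Fixpoint clusters n s z : seq (seq (R * 'rV[R]_d)) :=
  if n is n'.+1 then
    [:: (s, z)] :: flatten
      [seq [seq l1 ++ l2 | l1 <- clusters n' (s / 10) (subcenter s z u.1),
                           l2 <- clusters n' (s / 10) (subcenter s z u.2)]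
      | u <- [seq u <- enum {: offset * offset}
             | 8 * (s / 10) < `|subcenter s z u.1 - subcenter s z u.2| ]]
  else [::].

Lemma clustersSP n s z l : l \in clusters n.+1 s z <->
  l = [:: (s, z)] \/ exists u1 u2 l1 l2,
    [/\ 8 * (s / 10) < `|subcenter s z u1 - subcenter s z u2|,
      l1 \in clusters n (s / 10) (subcenter s z u1),
      l2 \in clusters n (s / 10) (subcenter s z u2) & l = l1 ++ l2].
Proof.
rewrite [clusters _ _ _]/= in_cons; split.
  case/orP => [/eqP ->|/flattenP[_ /mapP[u + ->] /allpairsP[[l1 l2] [h1 h2 ->]]]].
    by left.
  by rewrite mem_filter => /andP[sep _]; right; exists u.1, u.2, l1, l2.
case => [->|[u1 [u2 [l1 [l2 [sep h1 h2 ->]]]]]]; first by rewrite eqxx.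
apply/orP; right; apply/flattenP; exists
 [seq l1 ++ l2 | l1 <- clusters n (s / 10) (subcenter s z u1),
                 l2 <- clusters n (s / 10) (subcenter s z u2)].
  by apply/mapP; exists (u1, u2) => //; rewrite mem_filter sep mem_enum.
by apply/allpairsP; exists (l1, l2).
Qed.

Definition hits (Z : set (grain R d)) c := Z `&` cell c !=set0.

Definition bad (Z : set (grain R d)) n s z :=
  exists2 l, l \in clusters n s z & forall c, c \in l -> hits Z c.

Lemma bad_cell Z n s z : hits Z (s, z) -> bad Z n.+1 s z.
Proof.
move=> h; exists [:: (s, z)]; first by rewrite /= mem_head.
by move=> c; rewrite inE => /eqP ->.
Qed.

Lemma bad_pair Z n s z u1 u2 :
  8 * (s / 10) < `|subcenter s z u1 - subcenter s z u2| ->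
  bad Z n (s / 10) (subcenter s z u1) -> bad Z n (s / 10) (subcenter s z u2) ->
  bad Z n.+1 s z.
Proof.
move=> sep [l1 l1n h1] [l2 l2n h2]; exists (l1 ++ l2); last first.
  by move=> c; rewrite mem_cat => /orP[/h1|/h2].
by apply/clustersSP; right; exists u1, u2, l1, l2.
Qed.

(** The first exit makes the chain local, so that every grain on it would hit the
cell of [z] if its radius exceeded [s / 10].  The two ends of a chain of small
grains are more than [s] apart, hence the nodes near them more than
[s - 2 * (s / 10) = 8 * (s / 10)] apart, so that they cannot both be bad; around
one that is not bad the chain, possibly reversed, is a crossing that the
induction hypothesis excludes. *)
Lemma no_crossing (Z : set (grain R d)) n s z p ps : 0 < s ->
  ~ bad Z n s z -> path adj p ps ->
  (forall q, q \in p :: ps -> Z q) ->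
  (forall q, q \in p :: ps -> s / 10 ^+ n < (q.2 : R) <= s) ->
  `|p.1 - z| <= s -> `|(last p ps).1 - z| <= 2 * s.
Proof.
elim: n s z p ps => [|n IH] s z p ps s0 nbad pp hZ hr pz.
  have := hr p (mem_head _ _); rewrite expr0 divr1 => /andP[h1 h2].
  by have := lt_le_trans h1 h2; rewrite ltxx.
rewrite leNgt; apply/negP => lz.
have pz' : ~~ (2 * s < `|p.1 - z|) by rewrite -leNgt; lra.
have [qs [q [pq qz pre sub]]] := first_exit
   (a := fun p => 2 * s < `|p.1 - z|) pz' lz pp.
have memq w : w \in p :: rcons qs q -> w \in p :: ps.
  by rewrite !inE => /orP[->//|/sub ->]; rewrite orbT.
have [pqs adjq] : path adj p qs /\ adj (last p qs) q.
  by move: pq; rewrite rcons_path => /andP[].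
have qin : q \in p :: rcons qs q by rewrite inE mem_rcons mem_head orbT.
have lin : last p qs \in p :: rcons qs q.
  by rewrite -rcons_cons mem_rcons inE mem_last orbT.
have near_last : `|q.1 - z| <= 2 * s + q.2 + (last p qs).2.
  have := pre _ (mem_last p qs); rewrite -leNgt => h.
  move: adjq; rewrite /adj distrC => h2.
  have := ler_distD (last p qs).1 q.1 z; lra.
have small w : w \in p :: rcons qs q -> (w.2 : R) <= s / 10.
  move=> win; rewrite leNgt; apply/negP => w10.
  apply: nbad; apply: bad_cell; exists w; split; first exact/hZ/memq.
  have /andP[_ ws] := hr _ (memq _ win).
  split => /=; last by rewrite w10.
  move: win; rewrite -rcons_cons mem_rcons inE => /orP[/eqP->|/pre].
    have /andP[_ ?] := hr _ (memq _ qin).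
    have /andP[_ ?] := hr _ (memq _ lin); lra.
  by rewrite -leNgt; lra.
have hr' w : w \in p :: rcons qs q -> s / 10 / 10 ^+ n < (w.2 : R) <= s / 10.
  move=> win; rewrite small// andbT.
  have /andP[h _] := hr _ (memq _ win).
  by rewrite -mulrA -invfM -exprS.
(* nodes of the next grid near the start and near the end of the chain *)
have [u1 hu1] : exists u, `|p.1 - subcenter s z u| <= s / 10.
  by apply: subcenter_dense => //; lra.
have [u2 hu2] : exists u, `|q.1 - subcenter s z u| <= s / 10.
  apply: subcenter_dense => //.
  have := small _ qin; have := small _ lin; lra.
have dpq : s < `|p.1 - q.1|.
  have := ler_distD p.1 q.1 z; rewrite (distrC q.1 p.1); lra.
set z1 := subcenter s z u1 in hu1 *; set z2 := subcenter s z u2 in hu2 *.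
have s10 : 0 < s / 10 by lra.
have [b1|nb1] := pselect (bad Z n (s / 10) z1).
- have [b2|nb2] := pselect (bad Z n (s / 10) z2).
  + apply: nbad; apply: bad_pair b1 b2; rewrite -/z1 -/z2.
    have := ler_distD z1 p.1 q.1; have := ler_distD z2 z1 q.1.
    rewrite (distrC z2 q.1); lra.
  (* here the reversed chain crosses around the node near its end *)
  + have := IH _ _ q (rev (p :: qs)) s10 nb2 _ _ _ hu2.
    have E : q :: rev (p :: qs) = rev (p :: rcons qs q).
      by rewrite -rcons_cons rev_rcons.
    have pr : path adj q (rev (p :: qs)).
      have := rev_path adj p (rcons qs q).
      rewrite last_rcons belast_rcons => ->.
      by rewrite (@eq_path _ _ adj) // => w1 w2; exact: adj_sym.
    rewrite E => /(_ pr) h.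
    have {}h : `|(last q (rev (p :: qs))).1 - z2| <= 2 * (s / 10).
      by apply: h => w; rewrite mem_rev => wi; [exact/hZ/memq|exact: hr'].
    move: h; rewrite rev_cons last_rcons => h.
    have := ler_distD z2 p.1 q.1; rewrite (distrC z2 q.1); lra.
- have := IH _ _ p (rcons qs q) s10 nb1 pq (fun w h => hZ _ (memq _ h)) hr' hu1.
  rewrite last_rcons => h.
  have := ler_distD z1 p.1 q.1; rewrite (distrC z1 q.1); lra.
Qed.
End geometry.

(** * Disjointness of the cells and recursive bounds on the weights *)

Section weights.
Context (R : realType) (d : nat).
Implicit Types (x z : 'rV[R]_d) (s : R) (p q : grain R d).

(** Deeper trees include the shallower ones, so the bad events increase with the
depth and their union has a probability bounded by the common bound. *)
Lemma clusters_mono n s z : {subset clusters n s z <= clusters n.+1 s z}.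
Proof.
elim: n s z => [|n IH] s z l // /clustersSP[->|].
  by apply/clustersSP; left.
move=> [u1 [u2 [l1 [l2 [sep h1 h2 ->]]]]]; apply/clustersSP; right.
by exists u1, u2, l1, l2; split => //; exact: IH.
Qed.

(** A boolean relation, as [pairwise] requires. *)
Definition disjoint_cells (c c' : R * 'rV[R]_d) := `[< cell c `&` cell c' = set0 >].

(** Passing to a child costs [22 * (s / 10) + 4 * (s / 10) <= 4 * s], so the cells of
a tree stay in the ball of its root. *)
Lemma clusters_sub n s z l c p : 0 < s -> l \in clusters n s z -> c \in l ->
  cell c p -> `|p.1 - z| <= 4 * s.
Proof.
elim: n s z l => [|n IH] s z l s0 // /clustersSP[->|].
  by rewrite inE => /eqP -> [].
move=> [u1 [u2 [l1 [l2 [_ h1 h2 ->]]]]].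
have s10 : 0 < s / 10 by lra.
have key i : `|p.1 - subcenter s z i| <= 4 * (s / 10) -> `|p.1 - z| <= 4 * s.
  move=> k1; have := ler_distD (subcenter s z i) p.1 z.
  have := subcenter_near z i s0; lra.
rewrite mem_cat => /orP[cl|cl] cp.
  by apply: (key u1); exact: IH h1 cl cp.
by apply: (key u2); exact: IH h2 cl cp.
Qed.

(** Separated siblings carry disjoint balls, each containing the whole subtree; this
is what the distance [8 * (s / 10)] in [clusters] is for. *)
Lemma clusters_disjoint n s z l : 0 < s -> l \in clusters n s z ->
  pairwise disjoint_cells l.
Proof.
elim: n s z l => [|n IH] s z l s0 // /clustersSP[->//|].
move=> [u1 [u2 [l1 [l2 [sep h1 h2 ->]]]]].
have s10 : 0 < s / 10 by lra.
rewrite pairwise_cat (IH _ _ _ s10 h1) (IH _ _ _ s10 h2) !andbT.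
apply/allrelP => c1 c2 c1l c2l; apply/asboolP; rewrite -subset0 => p [p1 p2].
have k1 := clusters_sub s10 h1 c1l p1.
have k2 := clusters_sub s10 h2 c2l p2.
have := ler_distD p.1 (subcenter s z u1) (subcenter s z u2).
rewrite /= (distrC _ p.1); lra.
Qed.

(** If [h c] is the probability that the cell [c] is occupied, this is the expected
number of fully occupied lists of [clusters n s z]. *)
Definition weight (h : R * 'rV[R]_d -> R) n s z :=
  \sum_(l <- clusters n s z) \prod_(c <- l) h c.

Definition npairs := #|{: offset d * offset d}|.

Lemma weight_ge0 h n s z : (forall c, 0 <= h c) -> 0 <= weight h n s z.
Proof. by move=> h0; apply: sumr_ge0 => l _; apply: prodr_ge0. Qed.

(** The product over a concatenated list splits, so the sum over the pairs of
subtrees below two given children is the product of their weights. *)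
Lemma weightS h n s z (b : R) : (forall c, 0 <= h c) ->
  (forall u, weight h n (s / 10) (subcenter s z u) <= b) ->
  weight h n.+1 s z <= h (s, z) + npairs%:R * b ^+ 2.
Proof.
move=> h0 hb; rewrite /weight /= big_cons big_seq1 lerD2l big_flatten big_map.
rewrite big_filter /= big_enum_cond /=.
apply: le_trans (_ : \sum_(u : offset d * offset d) b ^+ 2 <= _); last first.
  by rewrite sumr_const mulr_natl.
rewrite big_mkcond; apply: ler_sum => u _.
case: ifPn => [_|_]; last exact: sqr_ge0.
rewrite big_allpairs_dep /=.
under eq_bigr => l1 _ do under eq_bigr => l2 _ do rewrite big_cat /=.
under eq_bigr => l1 _ do rewrite -mulr_sumr.
rewrite -mulr_suml expr2; apply: ler_pM; by [exact: weight_ge0|exact: hb].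
Qed.

(** The bound [2 * p] is stable under [b |-> p + N * b ^+ 2] when [4 * N * p <= 1],
hence it does not deteriorate with the depth. *)
Lemma weight_le h (p : R) n s z : (forall c, 0 <= h c <= p) ->
  4 * npairs%:R * p <= 1 -> weight h n s z <= 2 * p.
Proof.
move=> hp Np; have h0 c : 0 <= h c by have /andP[] := hp c.
have p0 : 0 <= p by have /andP[] := hp (s, z); exact: le_trans.
elim: n s z => [|n IH] s z; first by rewrite /weight big_nil mulr_ge0.
apply: le_trans (weightS (b := 2 * p) h0 _) _ => [u|]; first exact: IH.
have /andP[_ hsz] := hp (s, z).
have -> : npairs%:R * (2 * p) ^+ 2 = 4 * npairs%:R * p * p by ring.
have := ler_wpM2r p0 Np; lra.
Qed.

(** At scales where [h] vanishes the recursion is purely quadratic, and each factor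
[10] in the scale gains at least a factor [2]. *)
Lemma weight_decay h (p : R) n j z : (forall c, 0 <= h c <= p) ->
  4 * npairs%:R * p <= 1 -> (forall s z, 10 <= s -> h (s, z) = 0) ->
  weight h n (10 ^+ j) z <= 2 * p / 2 ^+ j.
Proof.
move=> hp Np hbig; have h0 c : 0 <= h c by have /andP[] := hp c.
have p0 : 0 <= p by have /andP[] := hp (0, z); exact: le_trans.
elim: j n z => [|j IH] n z; first by rewrite !expr0 divr1; exact: weight_le.
case: n => [|n].
  by rewrite /weight big_nil divr_ge0 ?mulr_ge0// exprn_ge0.
apply: le_trans (weightS (b := 2 * p / 2 ^+ j) h0 _) _ => [u|].
  by rewrite exprS [10 * _]mulrC mulfK//; exact: IH.
rewrite hbig ?add0r; last by rewrite exprS ler_peMr// exprn_ege1// ler1n.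
set e := (2 ^+ j)^-1; have e0 : 0 <= e by rewrite invr_ge0 exprn_ge0.
have e1 : e <= 1 by rewrite invf_le1 ?exprn_ege1 ?exprn_gt0 ?ler1n.
have -> : (2 ^+ j.+1)^-1 = 2^-1 * e by rewrite /e exprS invfM.
have -> : npairs%:R * (2 * p * e) ^+ 2 = (4 * npairs%:R * p) * (p * e * e) by ring.
have -> : 2 * p * (2^-1 * e) = p * e by field.
apply: le_trans (_ : p * e * e <= _); last by rewrite ler_piMr ?mulr_ge0.
by rewrite ler_piMl ?mulr_ge0.
Qed.
End weights.

(** * From unbounded components to crossings *)

Section chains.
Context (R : realType) (d : nat).
Implicit Types (x y z : 'rV[R]_d) (r : R) (Z : set (grain R d)).

Lemma eball_norm x r y : eball x r y -> `|y - x| < r.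
Proof.
rewrite /eball /= => yr; apply: le_lt_trans yr.
rewrite norm_rV_le ?sqrtr_ge0//; apply/forallP => i; rewrite !mxE.
rewrite -sqrtr_sqr ler_wsqrtr// (bigD1 i)//= lerDl.
by apply: sumr_ge0 => j _; exact: sqr_ge0.
Qed.

Lemma eball_open x r : open (eball x r).
Proof.
pose f y := Num.sqrt (\sum_(i < d) (y ord0 i - x ord0 i) ^+ 2).
have cf : continuous f.
  move=> y; apply: continuous_comp; last exact: sqrt_continuous.
  apply: (continuous_big (op := +%R)) => [|i _ t]; first exact: add_continuous.
  apply: (@continuous_comp _ _ _ (fun w : 'rV[R]_d => w ord0 i - x ord0 i)
    (fun u => u ^+ 2)); last exact: exprn_continuous.
  by move=> ?; apply: (cvgB (@coord_continuous R 1 d ord0 i t) (cvg_cst _)).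
rewrite (_ : eball x r = f @^-1` [set t | t < r])//.
by apply: open_comp => [y _|]; [exact: cf|exact: open_lt].
Qed.

(** The balls that a chain reaches from a grain covering [x] and the balls that no
chain reaches form two disjoint open sets covering the connected component. *)
Lemma component_chain Z x y : coverage Z x ->
  connected_component (coverage Z) x y ->
  exists p ps, [/\ path (@adj R d) p ps, forall q, q \in p :: ps -> Z q,
    eball p.1 p.2 x & eball (last p ps).1 (last p ps).2 y].
Proof.
move=> [p Zp px] [C [Cx CZ Cc] Cy].
pose reach q := exists2 ps, path (@adj R d) p ps /\
  (forall q, q \in p :: ps -> Z q) & last p ps = q.
pose V := \bigcup_(q in [set q | reach q]) eball q.1 q.2.
pose W := \bigcup_(q in [set q | Z q /\ ~ reach q]) eball q.1 q.2.
have oV : open V by apply: bigcup_open => q _; exact: eball_open.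
have oW : open W by apply: bigcup_open => q _; exact: eball_open.
have VW t : V t -> W t -> False.
  move=> [q [ps [pps hps] lq] qt] [q' [Zq' nq'] q't]; apply: nq'.
  exists (rcons ps q'); last by rewrite last_rcons.
  split; last first.
    move=> w; rewrite -rcons_cons mem_rcons inE => /orP[/eqP->//|]; exact: hps.
  rewrite rcons_path pps lq /= /adj.
  have h1 := eball_norm qt; have h2 := eball_norm q't.
  apply: le_lt_trans (ler_distD t q.1 q'.1) _; rewrite (distrC q.1).
  exact: ltrD.
have CVW t : C t -> V t \/ W t.
  move=> /CZ[q Zq qt]; have [rq|nrq] := pselect (reach q).
    by left; exists q.
  by right; exists q.
have px0 : reach p.
  by exists [::] => //; split => // q; rewrite inE => /eqP ->.
have E : C `&` V = C.
  apply: Cc.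
  - by exists x; split => //; exists p.
  - by exists V.
  - exists (~` W); first by rewrite closedC.
    apply/seteqP; split => t [Ct ht]; split => //; first exact: VW.
    by case: (CVW _ Ct).
have : V y by move: Cy; rewrite -E => -[].
move=> [q [ps [pps hps] <-] qy].
by exists p, ps.
Qed.

Lemma exp_archi (b : nat) (a : R) : (1 < b)%N -> exists n, a < b%:R ^+ n.
Proof.
move=> b1; exists (Num.truncn `|a|).+1.
apply: le_lt_trans (ler_norm a) _.
have /andP[_ h] := Num.Theory.truncn_itv (normr_ge0 a).
apply: lt_le_trans h _; rewrite -natrX ler_nat.
exact: ltnW (ltn_expl _ b1).
Qed.

Lemma scale_below_radii (qs : seq (grain R d)) s : (forall q, q \in qs -> 0 < (q.2 : R)) ->
  exists n, forall q, q \in qs -> s / 10 ^+ n < (q.2 : R).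
Proof.
elim: qs => [|q qs IH] h; first by exists 0%N.
have [w ww|n hn] := IH; first by apply: h; rewrite inE ww orbT.
have [m hm] := exp_archi (s / q.2) (isT : 1 < 10)%N.
have q0 : 0 < (q.2 : R) by apply: h; rewrite mem_head.
have e (k : nat) : 0 < 10 ^+ k :> R by rewrite exprn_gt0.
exists (n + m)%N => w; rewrite inE => /orP[/eqP ->|wq].
  rewrite ltr_pdivrMr// mulrC -ltr_pdivrMr//; apply: lt_le_trans hm _.
  by rewrite ler_eXn2l ?leq_addl// ltr1n.
have := hn _ wq; rewrite !ltr_pdivrMr// => hw; apply: lt_le_trans hw _.
by rewrite ler_pM2l; [rewrite ler_eXn2l ?leq_addr// ltr1n|apply: h; rewrite inE wq orbT].
Qed.

(** A chain has finitely many grains, so their radii exceed [10 ^+ j / 10 ^+ n] for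
some [n]; the centres of its ends differ from the points that they cover by at
most one. *)
Lemma unbounded_bad Z x j : Z `<=` @grain_space R d -> coverage Z x ->
  ~ bounded_set (connected_component (coverage Z) x) -> `|x| + 1 <= 10 ^+ j ->
  exists n, bad Z n (10 ^+ j) 0.
Proof.
move=> ZS Zx nb xj; apply: contrapT => nbad; apply: nb.
exists (2 * 10 ^+ j + 1); split; first exact: num_real.
move=> M hM y Cy; apply: le_trans (ltW hM).
have [p [ps [pps hps px py]]] := component_chain Zx Cy.
have rad q : q \in p :: ps -> 0 < (q.2 : R) <= 1 by move=> /hps /ZS.
have j1 : 1 <= 10 ^+ j :> R by rewrite exprn_ege1// ler1n.
have [n hn] := @scale_below_radii (p :: ps) (10 ^+ j) (fun q h => proj1 (andP (rad q h))).
have j0 : 0 < 10 ^+ j :> R by rewrite exprn_gt0.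
have : `|(last p ps).1 - 0| <= 2 * 10 ^+ j.
  apply: (@no_crossing R d Z n (10 ^+ j) 0 p ps j0 _ pps hps) => [|q qin|].
  - by move=> b; apply: nbad; exists n.
  - by have /andP[_ q1] := rad q qin; rewrite hn//=; exact: le_trans j1.
  - have := eball_norm px; have /andP[_ p1] := rad p (mem_head _ _).
    have := ler_distD x p.1 0; rewrite (distrC p.1 x) !subr0; lra.
have /andP[_ q1] := rad _ (mem_last p ps).
have := eball_norm py; have := ler_distD (last p ps).1 y 0; rewrite !subr0; lra.
Qed.
End chains.

(** * Intensity of a cell *)

Section volume.
Context (R : realType).

(** The closed sup-norm ball written coordinatewise, the form in which the coordinate
[sigma]-algebra and the recursion on the dimension see it. *)
Definition box n (z : 'rV[R]_n) (a : R) : set 'rV[R]_n :=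
  [set x | forall i, `|x ord0 i - z ord0 i| <= a].

Lemma box_norm n (z x : 'rV[R]_n) a : 0 <= a -> box z a x <-> `|x - z| <= a.
Proof.
move=> a0; rewrite norm_rV_le//; split => [h|/forallP h i].
  by apply/forallP => i; rewrite !mxE.
by have := h i; rewrite !mxE.
Qed.

Lemma dist_itv (u v a : R) : (`|u - v| <= a) = (u \in `[v - a, v + a]).
Proof. by rewrite ler_distl in_itv. Qed.

Lemma measurable_box n (z : 'rV[R]_n) a : measurable (box z a).
Proof.
rewrite (_ : box z a = \bigcap_(i in [set: 'I_n])
   ((fun x : 'rV[R]_n => x ord0 i : measurableTypeR R) @^-1`
     `[z ord0 i - a, z ord0 i + a])).
  apply: fin_bigcap_measurable => // i _.
  rewrite -[X in measurable X]setTI; apply: measurable_coord_rV => //.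
apply/seteqP; split => x h i; last by rewrite dist_itv; exact: h.
by move=> _ /=; rewrite -dist_itv; exact: h.
Qed.

Lemma lebesgue_box n (z : 'rV[R]_n) a : 0 <= a ->
  (lebesgue_rV R n (box z a) <= ((2 * a) ^+ n)%:E)%E.
Proof.
move=> a0; elim: n z => [|n IH] z.
  by rewrite expr0 /= probability_le1//; exact: measurable_box.
rewrite /= /lebesgue_rVS /pushforward.
pose z' : 'rV[R]_n := \row_j z ord0 (lift ord_max j).
rewrite (_ : _ @^-1` _ = box z' a `*` `[z ord0 ord_max - a, z ord0 ord_max + a]); last first.
  apply/seteqP; split => [[x t] h|[x t] [/= h1 h2] i].
    split => [i|] /=.
      by have := h (lift ord_max i); rewrite !mxE liftK.
    by have := h ord_max; rewrite !mxE unlift_none -dist_itv.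
  rewrite /rV_rcons mxE; case: unliftP => [j|] ->; last by rewrite dist_itv.
  by have := h1 j; rewrite mxE.
rewrite product_measure1E//; last exact: measurable_box.
rewrite [X in (_ * X <= _)%E](_ : _ = (2 * a)%:E).
  rewrite exprSr [leRHS]EFinM.
  by apply: lee_wpmul2r; [rewrite lee_fin; lra|exact: IH].
transitivity (@lebesgue_measure R `[z ord0 ord_max - a, z ord0 ord_max + a]%classic) => //.
rewrite lebesgue_measure_itv /= -EFinB lte_fin; case: ifPn => h; congr (_%:E); lra.
Qed.

Lemma cellE d (s : R) (z : 'rV[R]_d) : 0 <= s ->
  cell (s, z) = box z (4 * s) `*` `]s / 10, s].
Proof.
move=> s0; apply/seteqP; split => -[x r] [/= h1 h2]; split => //=.
- by apply/box_norm => //; lra.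
- by apply/box_norm => //; lra.
Qed.

Lemma cell_nonpos d (c : R * 'rV[R]_d) : c.1 <= 0 -> cell c = set0.
Proof. by move=> c0; rewrite -subset0 => p [_ /andP[h1 h2]]; lra. Qed.

Lemma measurable_cell d (c : R * 'rV[R]_d) : measurable (cell c).
Proof.
have [c0|/ltW c0] := leP c.1 0; first by rewrite cell_nonpos.
case: c c0 => s z s0; rewrite cellE//.
by apply: measurableX => //; exact: measurable_box.
Qed.

Lemma measurable_density d (s : R) (z : 'rV[R]_d) : 0 < s -> measurable_fun (cell (s, z))
  (fun p : grain R d => (if 0 < (p.2 : R) <= 1 then (p.2 : R) ^- d.+1 else 0)%:E : \bar R).
Proof.
move=> s0; have mc : measurable (cell (s, z)) by exact: measurable_cell.
apply/measurable_EFinP.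
have m2 : measurable_fun (cell (s, z)) (snd : grain R d -> measurableTypeR R).
  by apply: measurable_funTS; exact: measurable_snd.
apply: measurable_fun_if => //.
- by apply: measurable_and; [exact: measurable_fun_ltr|exact: measurable_fun_ler].
- apply: (@measurable_funS _ _ _ _ (cell (s, z))) => //.
  have mg : measurable_fun (`]0, +oo[%classic : set (measurableTypeR R))
      (fun r : R => r ^- d.+1 : measurableTypeR R).
    apply: open_continuous_measurable_fun; first exact: interval_open.
    move=> r; rewrite inE/= in_itv/= andbT => r0.
    apply: (@continuous_comp _ _ _ (fun t : R => t ^+ d.+1) (fun t => t^-1)).
      exact: exprn_continuous.
    by apply: inv_continuous; rewrite expf_neq0// gt_eqF.
  have := measurable_comp _ _ mg m2; apply => //.
  move=> _ [p [_ /andP[p2 _]] <-] /=; rewrite in_itv/= andbT.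
  by apply: lt_trans p2; rewrite divr_gt0.
Qed.

Lemma muE_ge0 d (B : set (grain R d)) : (0 <= muE B)%E.
Proof.
apply: integral_ge0 => p _; rewrite lee_fin; case: ifPn => // /andP[p0 _].
by rewrite invr_ge0 exprn_ge0// ltW.
Qed.

(** Scale invariance: the volume of the cell is of order [s ^+ d.+1] and the density
at most [(s / 10) ^- d.+1], so the bound does not depend on the scale. *)
Lemma muE_cell d (c : R * 'rV[R]_d) :
  (muE (cell c) <= (8 ^+ d * 10 ^+ d.+1)%:E)%E.
Proof.
have [c0|] := leP c.1 0.
  by rewrite cell_nonpos// /muE integral_set0 lee_fin mulr_ge0// exprn_ge0.
case: c => s z /= s0; have mc : measurable (cell (s, z)) by exact: measurable_cell.
have s10 : 0 < s / 10 by rewrite divr_gt0.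
apply: (@le_trans _ _ (\int[lebesgue_rV R d \x @lebesgue_measure R]_(p in cell (s, z))
   ((s / 10) ^- d.+1)%:E)%E).
  apply: ge0_le_integral => //.
  - move=> p _; rewrite lee_fin; case: ifPn => // /andP[p0 _].
    by rewrite invr_ge0 exprn_ge0// ltW.
  - exact: measurable_density.
  - move=> p [_ /= /andP[p1 p2]]; rewrite lee_fin.
    have p0 : 0 < (p.2 : R) by exact: lt_trans p1.
    case: ifPn => _; last by rewrite invr_ge0 exprn_ge0// ltW.
    by rewrite lef_pV2 ?posrE ?exprn_gt0// lerXn2r ?nnegrE// ltW.
rewrite integral_cst//.
have vol : ((lebesgue_rV R d \x @lebesgue_measure R) (cell (s, z)) =
    lebesgue_rV R d (box z (4 * s)) * (s - s / 10)%:E)%E.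
  rewrite cellE ?ltW// product_measure1E//; last exact: measurable_box.
  congr (_ * _)%E.
  transitivity (@lebesgue_measure R `]s / 10, s]%classic) => //.
  by rewrite lebesgue_measure_itv /= lte_fin -EFinB ifT//; lra.
rewrite [X in (_ * X <= _)%E]vol.
rewrite muleA.
have h0 : (0 <= ((s / 10) ^- d.+1)%:E :> \bar R)%E.
  by rewrite lee_fin invr_ge0 exprn_ge0// ltW.
apply: (@le_trans _ _ (((s / 10) ^- d.+1)%:E * ((2 * (4 * s)) ^+ d)%:E * (s - s / 10)%:E)%E).
  apply: lee_wpmul2r; first by rewrite lee_fin; lra.
  by apply: lee_wpmul2l => //; apply: lebesgue_box; lra.
rewrite -!EFinM lee_fin.
have -> : 2 * (4 * s) = 8 * s by ring.
have -> : (s / 10) ^- d.+1 * (8 * s) ^+ d * (s - s / 10) =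
   (8 ^+ d * 10 ^+ d.+1) * (9 / 10).
  rewrite expr_div_n exprMn invf_div !exprS; field.
  by rewrite (lt0r_neq0 s0) expf_neq0// (lt0r_neq0 s0).
by rewrite ler_piMr ?mulr_ge0 ?exprn_ge0//; lra.
Qed.
End volume.

(** * Probability of a crossing *)

Lemma counting_eq0 (T : choiceType) (R : realType) (A : set T) :
  counting A = 0%E :> \bar R -> A = set0.
Proof.
rewrite /counting; case: ifPn => // /asboolP fA [] /eqP.
by rewrite pnatr_eq0 finmap.cardfs_eq0 => /eqP; rewrite -(fset_set0) => /fset_set_inj; exact.
Qed.

Section probability.
Context (R : realType) (d : nat) dO (Om : measurableType dO)
  (P : probability Om R) (Psi : Om -> set (grain R d)) (l : R) (l0 : 0 < l)
  (hPsi : is_poisson_process P (@grain_space R d)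
        (fun B => (l%:E * muE B)%E) Psi).
Implicit Types (c : R * 'rV[R]_d) (s : R) (z : 'rV[R]_d).

Definition hit_event c := [set w | hits (Psi w) c].

Definition hit_prob c : R := fine (P (hit_event c)).

(** Occupation is expressed by the counts of points because measurability,
independence and the law of the process are given in terms of them. *)
Lemma hit_eventE c :
  hit_event c = [set w | (~` [set 0%E]) (counting (Psi w `&` cell c) : \bar R)].
Proof.
apply/seteqP; split => w /=.
  by move=> /set0P/negP h h0; apply: h; apply/eqP; exact: counting_eq0 h0.
move=> h; apply/set0P/negP => /eqP h0; apply: h; rewrite h0.
by rewrite measure0.
Qed.

Lemma measurable_hit c : measurable (hit_event c).
Proof.
rewrite hit_eventE -[X in measurable X]setTI.
apply: (poisson_process_measurable hPsi (measurable_cell c)) => //.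
by apply: measurableC; exact: emeasurable_set1.
Qed.

Lemma hit_probE c : P (hit_event c) = (hit_prob c)%:E.
Proof. by rewrite /hit_prob fineK// fin_num_measure//; exact: measurable_hit. Qed.

Lemma hit_prob_ge0 c : 0 <= hit_prob c.
Proof. by rewrite -lee_fin -hit_probE. Qed.

(** A Poisson variable of mean [a] is nonzero with probability [1 - expR (- a) <= a]. *)
Lemma hit_prob_le c : hit_prob c <= l * (8 ^+ d * 10 ^+ d.+1).
Proof.
have mle := muE_cell c; have m0 := muE_ge0 (cell c).
have mfin : muE (cell c) \is a fin_num.
  by rewrite ge0_fin_numE//; apply: le_lt_trans mle _; rewrite ltry.
have := poisson_process_fin hPsi (a := l * fine (muE (cell c))) 0
  (measurable_cell c).
rewrite EFinM fineK// expr0 mulr1 fact0 divr1 => /(_ erefl) h0.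
have E : hit_event c = ~` [set w | counting (Psi w `&` cell c) = 0%:R%:E :> \bar R].
  by rewrite hit_eventE.
rewrite -lee_fin -hit_probE E probability_setC; last first.
  rewrite -[X in measurable X]setTI.
  exact: (poisson_process_measurable hPsi (measurable_cell c) measurableT
    (emeasurable_set1 _)).
rewrite h0 -EFinB lee_fin.
have := expR_ge1Dx (- (l * fine (muE (cell c)))).
have : l * fine (muE (cell c)) <= l * (8 ^+ d * 10 ^+ d.+1).
  by rewrite ler_pM2l// -lee_fin fineK.
lra.
Qed.

(** Such a cell only contains radii larger than one. *)
Lemma hit_prob_big s z : 10 <= s -> hit_prob (s, z) = 0.
Proof.
move=> s10; rewrite /hit_prob (_ : hit_event _ = set0) ?measure0//.
rewrite -subset0 => w [p [/(poisson_process_sub hPsi) /andP[_ p1] [_ /= /andP[p2 _]]]].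
lra.
Qed.

Definition cluster_event (cs : seq (R * 'rV[R]_d)) :=
  \bigcap_(c in [set` cs]) hit_event c.

Lemma measurable_cluster_event cs : measurable (cluster_event cs).
Proof. by apply: fin_bigcap_measurable => // c _; exact: measurable_hit. Qed.

Lemma cluster_event_prob cs : pairwise (@disjoint_cells R d) cs ->
  P (cluster_event cs) = (\prod_(c <- cs) hit_prob c)%:E.
Proof.
move=> /pairwiseP dcs.
have tr : trivIset [set: 'I_(size cs)] (fun i => cell (tnth (in_tuple cs) i)).
  apply/trivIsetP => i j _ _ ij.
  rewrite !(tnth_nth (0, 0)) /=.
  wlog lt_ij : i j ij / (i < j)%N.
    move=> h; have [|ji|/val_inj e] := ltngtP i j; first exact: h.
      by rewrite setIC; apply: h ji; rewrite eq_sym.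
    by rewrite e eqxx in ij.
  by apply/asboolP; apply: dcs; rewrite ?inE/=.
have := @poisson_process_indep _ _ _ _ _ _ _ _ _ hPsi (size cs)
  (fun i => cell (tnth (in_tuple cs) i)) (fun=> ~` [set 0%E])
  (fun i => measurable_cell _) tr.
have -> : [set w | forall i, (~` [set 0%E])
     (counting (Psi w `&` cell (tnth (in_tuple cs) i)) : \bar R)] = cluster_event cs.
  apply/seteqP; split => w h.
    move=> c /= /(tnthP (in_tuple cs))[i ->].
    by rewrite hit_eventE; exact: h.
  move=> i; have := h (tnth (in_tuple cs) i) (mem_tnth i _).
  by rewrite hit_eventE.
move=> -> => [|i]; last by apply: measurableC; exact: emeasurable_set1.
rewrite big_tnth -prodEFin; apply: eq_bigr => i _.
by rewrite -hit_probE hit_eventE.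
Qed.

Definition bad_event n s z := [set w | bad (Psi w) n s z].

Lemma bad_eventE n s z :
  bad_event n s z = \big[setU/set0]_(cs <- clusters n s z) cluster_event cs.
Proof. by rewrite -bigcup_seq. Qed.

Lemma measurable_bad_event n s z : measurable (bad_event n s z).
Proof.
by rewrite bad_eventE; apply: bigsetU_measurable => cs _; exact: measurable_cluster_event.
Qed.

(** A union bound over the trees; within one tree the cells are disjoint, so their
occupation events are independent. *)
Lemma bad_event_prob n s z : 0 < s ->
  (P (bad_event n s z) <= (weight hit_prob n s z)%:E)%E.
Proof.
move=> s0; rewrite bad_eventE /weight.
have := fun cs => @clusters_disjoint R d n s z cs s0.
elim: (clusters n s z) => [|cs css IH] h; first by rewrite !big_nil measure0.
rewrite !big_cons EFinD -cluster_event_prob; last by apply: h; rewrite mem_head.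
apply: le_trans (measureU2 _ _ _) _; first exact: measurable_cluster_event.
  by apply: bigsetU_measurable => ? _; exact: measurable_cluster_event.
by apply: leeD2l; apply: IH => ? H; apply: h; rewrite inE H orbT.
Qed.

Lemma bad_limit_prob (p : R) j : (forall c, hit_prob c <= p) ->
  4 * (npairs d)%:R * p <= 1 ->
  (P (\bigcup_n bad_event n (10 ^+ j) 0) <= (2 * p / 2 ^+ j)%:E)%E.
Proof.
move=> hp Np.
have mU : measurable (\bigcup_n bad_event n (10 ^+ j) 0).
  by apply: bigcupT_measurable => n; exact: measurable_bad_event.
have nd : nondecreasing_seq (fun n => bad_event n (10 ^+ j) 0).
  apply/nondecreasing_seqP => n; apply/subsetPset => w [cs h1 h2].
  by exists cs => //; exact: clusters_mono.
have cv := nondecreasing_cvg_mu (mu := P)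
  (fun n => measurable_bad_event n (10 ^+ j) 0) mU nd.
rewrite -(cvg_lim _ cv)//; apply: lime_le; first by apply/cvg_ex; eexists; exact: cv.
apply: nearW => n /=.
apply: le_trans (bad_event_prob _ _ _) _; first by rewrite exprn_gt0.
rewrite lee_fin; apply: weight_decay => //; last exact: hit_prob_big.
by move=> c; rewrite hit_prob_ge0 hp.
Qed.

(** An unbounded component makes [E j] happen for all large [j], while [P (E j)] tends
to zero. *)
Lemma ae_bounded_components :
  4 * (npairs d)%:R * (l * (8 ^+ d * 10 ^+ d.+1)) <= 1 ->
  {ae P, forall w, only_bounded_components (coverage (Psi w))}.
Proof.
set p := l * _ => Np.
pose E j := \bigcup_n bad_event n (10 ^+ j) 0.
pose F J := \bigcap_(j in [set j | (J <= j)%N]) E j.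
have mE j : measurable (E j).
  by apply: bigcupT_measurable => n; exact: measurable_bad_event.
have mF J : measurable (F J) by apply: bigcap_measurableType => j _; exact: mE.
have PF J : P (F J) = 0%E.
  apply/eqP; rewrite eq_le measure_ge0 andbT leNgt; apply/negP => F0.
  have Ffin : P (F J) \is a fin_num by rewrite fin_num_measure.
  have f0 : 0 < fine (P (F J)) by rewrite -lte_fin fineK.
  have [n hn] := exp_archi (2 * p / fine (P (F J))) (isT : 1 < 2)%N.
  pose j := (J + n)%N.
  have : (P (F J) <= (2 * p / 2 ^+ j)%:E)%E.
    apply: le_trans (bad_limit_prob j hit_prob_le Np).
    apply: le_measure; [exact/mem_set/mF|exact/mem_set/mE|].
    by move=> w; apply; rewrite /= leq_addr.
  rewrite -[P _]fineK// lee_fin ler_pdivlMr ?exprn_gt0// mulrC.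
  rewrite -ler_pdivlMr// leNgt => /negP; apply.
  by apply: lt_le_trans hn _; rewrite ler_eXn2l ?leq_addl ?ltr1n.
rewrite /almost_everywhere /=.
have : P.-negligible (\bigcup_J F J).
  by apply: (@negligible_bigcup _ _ _ P F) => k; exists (F k); split;
    [exact: mF|exact: PF|].
apply: negligibleS => w /= /existsNP[x /not_implyP[Ux nb]].
have [J hJ] := exp_archi (`|x| + 1) (isT : 1 < 10)%N.
exists J => // j /= Jj.
have ZS : Psi w `<=` @grain_space R d by exact: (poisson_process_sub hPsi).
have [|n hn] := unbounded_bad (j := j) ZS Ux nb.
  by apply: le_trans (ltW hJ) _; rewrite ler_eXn2l// ltr1n.
by exists n.
Qed.
End probability.

Theorem theorem1p3 (R : realType) (d : nat) (hd : (1 <= d)%N)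
    (dO : R -> measure_display) (Om : forall l : R, measurableType (dO l))
    (P : forall l : R, probability (Om l) R)
    (Psi : forall l : R, Om l -> set (grain R d))
    (hPsi : forall l : R, 0 < l ->
      is_poisson_process (P l) (@grain_space R d)
        (fun B => (l%:E * muE B)%E) (Psi l)) :
  (0 < lambda_sheet P Psi)%E.
Proof.
pose M : R := 8 ^+ d * 10 ^+ d.+1.
have M0 : 0 <= M by rewrite mulr_ge0// exprn_ge0.
pose A := 4 * (npairs d)%:R * M.
have A0 : 0 <= A by rewrite !mulr_ge0.
(* any positive [l] with [A * l <= 1] will do *)
pose l := (A + 1)^-1.
have l0 : 0 < l by rewrite invr_gt0; lra.
apply: (@lt_le_trans _ _ l%:E); first by rewrite lte_fin.
apply: ereal_sup_ubound; right; exists l => //; split => //.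
apply: (ae_bounded_components l0 (hPsi _ l0)).
rewrite mulrCA -/M -/A ler_pdivrMl; lra.
Qed.
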